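(* Let $p$ be a prime and let $G=Q_{4p}$. Then $\mathcal{B}(G)$ is hypoenergetic, and it is not hyperenergetic, not L-hyperenergetic, not Q-hyperenergetic and not CN-hyperenergetic.
   Context: $Q_{4m}=\langle a,b : a^{2m}=1,\ b^2=a^m,\ bab^{-1}=a^{-1}\rangle$ is the dicyclic group of order $4m$. For a finite group $G$, let $L(G)$ be the set of all subgroups of $G$. The subgroup generating bipartite graph $\mathcal{B}(G)$ is the simple bipartite graph with vertex set the disjoint union of $G\times G$ and $L(G)$, in which $(a,b)\in G\times G$ and $H\in L(G)$ are adjacent if and only if $H$ is the subgroup generated by $a$ and $b$ (and there are no other edges). For a finite simple graph $\Gamma$ with $n$ vertices $v_1,\dots,v_n$ and $m$ edges, let $A$ be its adjacency matrix, $D$ its diagonal degree matrix, and $CN(\Gamma)$ the common neighborhood matrix, whose $(i,j)$ entry for $i\neq j$ is the number of vertices other than $v_i,v_j$ adjacent to both $v_i$ and $v_j$, with zero diagonal. The energy $E(\Gamma)$ and the common neighborhood energy $E_{CN}(\Gamma)$ are the sums of absolute values of the eigenvalues (with multiplicity) of $A$ and $CN(\Gamma)$ respectively. The Laplacian energy is $LE(\Gamma)=\sum_{\lambda}|\lambda-\frac{2m}{n}|$ over the eigenvalues $\lambda$ of $D-A$, and the signless Laplacian energy is $LE^+(\Gamma)=\sum_{\mu}|\mu-\frac{2m}{n}|$ over the eigenvalues $\mu$ of $D+A$ (both counted with multiplicity). With $K_n$ the complete graph on $n=|V(\Gamma)|$ vertices, $\Gamma$ is called hypoenergetic if $E(\Gamma)<n$;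 hyperenergetic if $E(\Gamma)>E(K_n)$; L-hyperenergetic if $LE(\Gamma)>LE(K_n)$; Q-hyperenergetic if $LE^+(\Gamma)>LE^+(K_n)$; CN-hyperenergetic if $E_{CN}(\Gamma)>E_{CN}(K_n)$. Here $E(K_n)=LE(K_n)=LE^+(K_n)=2(n-1)$ and $E_{CN}(K_n)=2(n-1)(n-2)$. *)

(* Defs.v *)
From HB Require Import structures.
From mathcomp Require Import all_boot all_order all_algebra.
From mathcomp Require Import all_fingroup all_solvable all_field.

Set Implicit Arguments.
Unset Strict Implicit.
Unset Printing Implicit Defensive.

Import Order.TTheory GRing.Theory Num.Theory.

Local Open Scope ring_scope.

Record sgraph (V : finType) := SGraph {
  edge :> rel V;
  edge_sym : symmetric edge;
  edge_irrefl : irreflexive edge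
}.

(* The eigenvalues of M, listed with algebraic multiplicity.  Matrices below
   have rational entries, so all their complex eigenvalues lie in algC. *)
Definition eigenvalues n (M : 'M[algC]_n) : seq algC :=
  sval (closed_field_poly_normal (char_poly M)).

Lemma eigenvaluesP n (M : 'M[algC]_n) :
  char_poly M = \prod_(z <- eigenvalues M) ('X - z%:P).
Proof.
rewrite /eigenvalues; case: closed_field_poly_normal => s /= {1}->.
by rewrite (monicP (char_poly_monic M)) scale1r.
Qed.

Section GraphEnergies.

Variables (V : finType) (E : sgraph V).

Definition degree (u : V) : nat := #|[set w | E u w]|.

Definition edges : {set {set V}} :=
  [set [set e.1; e.2] | e : V * V & E e.1 e.2].

(* Matrices are indexed by 'I_#|V| through the enumeration of V. *)
Definition vertex_mx (f : V -> V -> algC) : 'M[algC]_#|V| :=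
  \matrix_(i, j) f (enum_val i) (enum_val j).

Definition adjacency_mx := vertex_mx (fun u v => (E u v)%:R).

Definition degree_mx :=
  vertex_mx (fun u v => if u == v then (degree u)%:R else 0).

Definition common_nbrs (u v : V) : {set V} :=
  [set w | [&& w != u, w != v, E u w & E v w]].

Definition common_nbr_mx :=
  vertex_mx (fun u v => if u == v then 0 else #|common_nbrs u v|%:R).

Definition avg_degree : algC := (2 * #|edges|)%N%:R / #|V|%:R.

Definition energy : algC :=
  \sum_(x <- eigenvalues adjacency_mx) `|x|.

Definition cn_energy : algC :=
  \sum_(x <- eigenvalues common_nbr_mx) `|x|.

Definition laplacian_energy : algC :=
  \sum_(x <- eigenvalues (degree_mx - adjacency_mx)) `|x - avg_degree|.

Definition signless_laplacian_energy : algC :=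
  \sum_(x <- eigenvalues (degree_mx + adjacency_mx)) `|x - avg_degree|.

End GraphEnergies.

Lemma complete_sym (V : finType) : symmetric (fun u v : V => u != v).
Proof. by move=> u v; rewrite eq_sym. Qed.

Lemma complete_irrefl (V : finType) : irreflexive (fun u v : V => u != v).
Proof. by move=> u; rewrite eqxx. Qed.

Definition complete_graph (V : finType) : sgraph V :=
  SGraph (@complete_sym V) (@complete_irrefl V).

(* All the energies are sums of moduli, hence nonnegative reals, on which the
   partial order of algC is the usual total order. *)
Section Hyperenergetic.

Variables (V : finType) (E : sgraph V).

Definition hypoenergetic : bool := energy E < #|V|%:R.

Definition hyperenergetic : bool :=
  energy E > energy (complete_graph V).

Definition L_hyperenergetic : bool :=
  laplacian_energy E > laplacian_energy (complete_graph V).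

Definition Q_hyperenergetic : bool :=
  signless_laplacian_energy E > signless_laplacian_energy (complete_graph V).

Definition CN_hyperenergetic : bool :=
  cn_energy E > cn_energy (complete_graph V).

End Hyperenergetic.

Section SubgroupGeneratingBipartiteGraph.

Variable gT : finGroupType.

Definition sgb_edge (u v : gT * gT + {group gT}) : bool :=
  match u, v with
  | inl x, inr H | inr H, inl x => <<[set x.1; x.2]>>%g == H :> {set gT}
  | _, _ => false
  end.

Lemma sgb_edge_sym : symmetric sgb_edge.
Proof. by case=> [x|H] [y|K]. Qed.

Lemma sgb_edge_irrefl : irreflexive sgb_edge.
Proof. by case. Qed.

Definition sgb_graph : sgraph (gT * gT + {group gT})%type :=
  SGraph sgb_edge_sym sgb_edge_irrefl.

End SubgroupGeneratingBipartiteGraph.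

(* Isomorphism type of <a, b | a^(2m) = 1, b^2 = a^m, b a b^-1 = a^-1>.
   "\isog Grp" denotes the largest finite group with this presentation, which
   is the presented group itself since the latter is finite for m > 0. *)
Definition dicyclic (m : nat) (gT : finGroupType) (G : {set gT}) : Prop :=
  (G \isog Grp (a : b : a ^+ (2 * m), b ^+ 2 = a ^+ m,
                        b * a * b^-1 = a^-1))%g.

(* Main.v *)
Require Import Defs.
From mathcomp Require Import all_boot all_order all_algebra.
From mathcomp Require Import all_fingroup all_solvable all_field.
From mathcomp Require Import ring zify.

(** The subgroup generating bipartite graph of a finite group is a disjoint
    union of stars: a pair (a, b) is joined to the single subgroup it generates,
    so each subgroup H is the hub of a star with d_H leaves, where d_H is the
    number of pairs generating H.  Write N for the number of leaves, s for the
    number of hubs and n = N + s; then the sum of the d_H is N.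

    All the spectra come from one principle: U W and W U have the same
    eigenvalues up to zeros [eigenvalues_mulC].  If M = b 1 + U W and W U is
    diagonal, the spectrum of M is therefore known [sum_eigenvalues_mulmx].
    For a star forest, take two columns in U for every hub, supported on its
    star and constant on its leaves; W is a dual family
    [sum_eigenvalues_star].  Up to copies of b, star y contributes
      - the eigenvalues sqrt d_y and - sqrt d_y to A (b = 0),
      - the eigenvalues 0 and d_y + 1 to D - A and D + A (b = 1),
      - the eigenvalues d_y - 1 and 0 to CN (b = -1).
    For the complete graph all the matrices are b 1 + a J with J the all-ones
    matrix, and one column is enough [sum_eigenvalues_complete].

    The energy is then the sum of the 2 sqrt d_y <= d_y + 1, hence at most n,
    with equality only if every d_y is 1 [energy_star_leif].  Since n <= 2(n-1),
    the graph is not hyperenergetic.  With c = 2N/n the average degree,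
    |d_y + 1 - c| <= d_y + |1 - c| bounds both Laplacian energies by
    N + s c + N |1 - c|, and |1 - c| = |s - N|/n <= (n - 2)/n makes this at most
    2(n-1) [star_laplacian_energy_le].  The common neighborhood energy is at
    most 2N <= 2(n-1)(n-2) [cn_energy_star_le].

    The only input from the group is that it is nontrivial: a dicyclic group
    has a quotient of order 2, and in a nontrivial group exactly one generating
    pair is impossible, because (a, b) and (b, a) generate the same subgroup,
    as do (a, a) and (1, a).  This makes the energy bound strict. *)

Set Implicit Arguments.
Unset Strict Implicit.
Unset Printing Implicit Defensive.
Import Order.TTheory GRing.Theory Num.Theory.
Local Open Scope ring_scope.

(** * Eigenvalues of products *)

(** Both sides are the determinant of the block matrix (X U; W 1) multiplied by
    a power of X: eliminate W by column operations on one side, by row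
    operations on the other. *)
Lemma char_poly_mulC (R : comNzRingType) n k
    (U : 'M[R]_(n, k)) (W : 'M_(k, n)) :
  char_poly (U *m W) * 'X^k = char_poly (W *m U) * 'X^n.
Proof.
pose Up := map_mx polyC U; pose Wp := map_mx polyC W.
pose P := block_mx 'X%:M Up Wp 1%:M.
have PL : P *m block_mx 1%:M 0 (- Wp) 1%:M =
          block_mx (char_poly_mx (U *m W)) Up 0 1%:M.
  rewrite mulmx_block !mulmx1 !mulmx0 !mul1mx !add0r mulmxN subrr.
  by rewrite /char_poly_mx map_mxM.
have PR : block_mx 1%:M 0 (- Wp) 'X%:M *m P =
          block_mx 'X%:M Up 0 (char_poly_mx (W *m U)).
  rewrite mulmx_block !mulmx1 !mul0mx !mul1mx !addr0 !mulNmx.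
  by rewrite scalar_mxC addNr addrC /char_poly_mx map_mxM.
move/(congr1 determinant): PL; move/(congr1 determinant): PR.
rewrite !det_mulmx !(det_ublock, det_lblock) !det1 !det_scalar !mulr1 !mul1r.
by rewrite /char_poly => PR <-; rewrite mulrC PR mulrC.
Qed.

Lemma char_polyD_scalar (R : comNzRingType) n (b : R) (M : 'M[R]_n) :
  char_poly (b%:M + M) = char_poly M \Po ('X - b%:P).
Proof.
rewrite /char_poly -det_map_mx; congr (\det _).
apply/matrixP=> i j; rewrite !mxE.
rewrite rmorphB rmorphMn /= comp_polyX comp_polyC.
by rewrite polyCD polyCMn mulrnBl opprD addrA.
Qed.

Lemma perm_eigenvalues n (M : 'M[algC]_n) (s : seq algC) :
  char_poly M = \prod_(z <- s) ('X - z%:P) -> perm_eq (eigenvalues M) s.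
Proof. by rewrite eigenvaluesP => /prod_XsubC_eq. Qed.

Lemma eigenvaluesD_scalar n (b : algC) (M : 'M[algC]_n) :
  perm_eq (eigenvalues (b%:M + M)) [seq b + z | z <- eigenvalues M].
Proof.
apply: perm_eigenvalues; rewrite char_polyD_scalar eigenvaluesP rmorph_prod.
rewrite big_map; apply: eq_bigr => z _.
by rewrite rmorphB /= comp_polyX comp_polyC polyCD opprD addrA.
Qed.

Lemma eigenvalues_mulC n k (U : 'M[algC]_(n, k)) (W : 'M_(k, n)) :
  perm_eq (eigenvalues (U *m W) ++ nseq k 0) (eigenvalues (W *m U) ++ nseq n 0).
Proof.
apply: prod_XsubC_eq; rewrite !big_cat /= -!eigenvaluesP !big_nseq.
by rewrite !subr0 -!Monoid.iteropE /=; apply: char_poly_mulC.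
Qed.

Lemma eigenvalues_diag n (d : 'rV[algC]_n) :
  perm_eq (eigenvalues (diag_mx d)) [seq d 0 i | i : 'I_n].
Proof.
apply: perm_eigenvalues; rewrite char_poly_trig ?diag_mx_is_trig //.
rewrite big_image /=.
by apply: eq_bigr => i _; rewrite !mxE eqxx.
Qed.

(** The multiplicity of b is stated with both sizes on the side where they are
    added, so that it makes sense also when k exceeds n. *)
Lemma sum_eigenvalues_mulmx n k
    (U : 'M[algC]_(n, k)) (W : 'M_(k, n)) (d : 'rV_k)
    (b : algC) (g : algC -> algC) :
  W *m U = diag_mx d ->
  \sum_(x <- eigenvalues (b%:M + U *m W)) g x + g b *+ k =
    \sum_i g (b + d 0 i) + g b *+ n.
Proof.
move=> WU; rewrite (perm_big _ (eigenvaluesD_scalar b _)) big_map.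
have := eigenvalues_mulC U W; rewrite WU => /(perm_big _) /= swapE.
have {swapE}: \sum_(z <- eigenvalues (U *m W) ++ nseq k 0) g (b + z) =
    \sum_(z <- eigenvalues (diag_mx d) ++ nseq n 0) g (b + z) by exact: swapE.
rewrite !big_cat !big_nseq /= !iter_addr_0 !addr0 => ->.
by rewrite (perm_big _ (eigenvalues_diag d)) big_image.
Qed.

Lemma sum_enum_val (K : finType) (F : K -> algC) :
  \sum_(i < #|K|) F (enum_val i) = \sum_k F k.
Proof. by rewrite -(big_enum_val (A := K)); apply: eq_bigl. Qed.

(** The previous lemma with rows and columns indexed by arbitrary finite types:
    the enumeration of the vertices disappears here once and for all. *)
Lemma sum_eigenvalues_vertex_mx (V K : finType) (M : V -> V -> algC)
    (U : V -> K -> algC) (W : K -> V -> algC) (d : K -> algC)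
    (b : algC) (g : algC -> algC) :
  (forall u v, M u v = b *+ (u == v) + \sum_k U u k * W k v) ->
  (forall k l, \sum_v W k v * U v l = d k *+ (k == l)) ->
  \sum_(x <- eigenvalues (vertex_mx M)) g x + g b *+ #|K| =
    \sum_k g (b + d k) + g b *+ #|V|.
Proof.
move=> ME WU.
pose mx (S T : finType) (f : S -> T -> algC) : 'M_(#|S|, #|T|) :=
  \matrix_(i, j) f (enum_val i) (enum_val j).
have ->: vertex_mx M = b%:M + mx _ _ U *m mx _ _ W.
  apply/matrixP=> i j; rewrite !mxE ME (inj_eq enum_val_inj); congr (_ + _).
  by rewrite -sum_enum_val; apply: eq_bigr => k _; rewrite !mxE.
rewrite (sum_eigenvalues_mulmx _ _ (d := \row_k d (enum_val k))).
  congr (_ + _); rewrite -[RHS]sum_enum_val.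
  by apply: eq_bigr => k _; rewrite mxE.
apply/matrixP=> i j; rewrite !mxE -(inj_eq enum_val_inj) -WU -[RHS]sum_enum_val.
by apply: eq_bigr => k _; rewrite !mxE.
Qed.

(** * Counting edges *)

Lemma handshake (V : finType) (E : sgraph V) :
  (2 * #|edges E| = \sum_u degree E u)%N.
Proof.
pose ends (e : V * V) := [set e.1; e.2].
have ->: (\sum_u degree E u = \sum_(e in [set e : V * V | E e.1 e.2]) 1)%N.
  under eq_bigr => u _ do rewrite /degree -sum1dep_card.
  rewrite (pair_big_dep xpredT E (fun _ _ => 1%N)).
  by apply: eq_big => [e|//]; rewrite inE.
rewrite (partition_big_imset ends) mulnC -sum_nat_const /=.
(* An edge {u, v} is the image of exactly two ordered pairs. *)
apply: eq_bigr => _ /imsetP[[u v] uv ->]; rewrite inE /= in uv.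
have neq_uv: u != v by apply: contraTneq uv => ->; rewrite edge_irrefl.
rewrite sum1dep_card -[LHS](_ : #|[set (u, v); (v, u)]| = 2)%N; last first.
  by rewrite cards2 xpair_eqE negb_and neq_uv.
apply: eq_card => -[x y]; rewrite !inE !xpair_eqE /=.
apply/idP/idP => [/orP[]|] /andP[].
- by move=> /eqP-> /eqP->; rewrite uv eqxx.
- by move=> /eqP-> /eqP->; rewrite edge_sym uv /ends setUC eqxx.
move=> xy /eqP/setP xyuv.
have neq_xy: x != y by apply: contraTneq xy => ->; rewrite edge_irrefl.
have := xyuv x; have := xyuv y; rewrite /ends !inE !eqxx orbT /=.
have [eq_xu|_ yuv /esym/eqP eq_xv] := eqVneq x u.
  by rewrite -eq_xu [y == x]eq_sym (negPf neq_xy) /= => <-.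
move: yuv; rewrite -eq_xv [y == x]eq_sym (negPf neq_xy) orbF => <-.
by rewrite eqxx.
Qed.

(** The arithmetic behind the Laplacian energies of a star forest with x + 1
    leaves and y + 1 hubs, whose average degree is a: the hypothesis is what
    the spectrum and the triangle inequality give for the energy S, and the
    slack in the conclusion is at least 2 y (y + 1) / (x + y + 2). *)
Lemma star_laplacian_bound (x y S : algC) (a := 2 * (x + 1) / (x + y + 2)) :
  0 <= x -> 0 <= y ->
  S + `|1 - a| * (2 * (y + 1)) <=
    (x + 1) + (`|1 - a| + a) * (y + 1) + `|1 - a| * (x + y + 2) ->
  S <= 2 * (x + y + 1).
Proof.
move=> x0 y0 le_S; set t := `|1 - a| in le_S.
have n_gt0 : 0 < x + y + 2 by rewrite ltr_wpDl ?addr_ge0 ?ltr0n.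
have n0 : x + y + 2 != 0 by rewrite gt_eqF.
have le_t : t <= (x + y) / (x + y + 2).
  have -> : t = `|y - x| / (x + y + 2).
    rewrite /t -[in RHS](ger0_norm (ltW n_gt0)) -normf_div; congr `|_|.
    by rewrite /a; field.
  rewrite ler_pM2r ?invr_gt0 // (le_trans (ler_normB _ _)) //.
  by rewrite !ger0_norm // addrC.
(* Of the multiples of t only x + 1 copies are left, one for each leaf. *)
have {le_S} : S <= (x + 1) + a * (y + 1) + (x + 1) * t.
  suff <- : (S + t * (2 * (y + 1)) <=
      (x + 1) + (t + a) * (y + 1) + t * (x + y + 2)) =
    (S <= (x + 1) + a * (y + 1) + (x + 1) * t) by [].
  by rewrite -subr_ge0 -[RHS]subr_ge0; congr (0 <= _); ring.
move/le_trans; apply.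
pose T := x + 1 + a * (y + 1) + (x + 1) * ((x + y) / (x + y + 2)).
rewrite (@le_trans _ _ T) //.
  by rewrite lerD2l ler_wpM2l ?addr_ge0.
rewrite -subr_ge0.
have -> : 2 * (x + y + 1) - T = 2 * y * (y + 1) / (x + y + 2).
  by rewrite /T /a; field.
by rewrite divr_ge0 ?mulr_ge0 ?addr_ge0 ?ler0n.
Qed.

(** * Spectra of star forests *)

Section StarForest.

Variables (X Y : finType) (h : X -> Y).

Definition hub (u : X + Y) : Y := match u with inl x => h x | inr y => y end.
Definition leaf (u : X + Y) : bool := if u is inl _ then true else false.
Definition nleaves (y : Y) : nat := #|[set x | h x == y]|.

(** The disjoint union of the stars with hub y and the fiber of h over y as its
    leaves; a hub may be isolated.  Comparing hubs means comparing stars. *)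
Definition star_forest (E : sgraph (X + Y)%type) : Prop :=
  forall u v, E u v = (hub u == hub v) && (leaf u != leaf v).

Lemma sum_nleaves : (\sum_y nleaves y = #|X|)%N.
Proof.
rewrite -sum1_card (partition_big h xpredT) //=.
by apply: eq_bigr => y _; rewrite /nleaves -sum1dep_card.
Qed.

Lemma sum_nleavesS : \sum_y ((nleaves y)%:R + 1) = (#|X| + #|Y|)%:R :> algC.
Proof. by rewrite big_split /= sumr_const -natr_sum sum_nleaves -natrD. Qed.

Lemma nleaves_hub_gt0 u : leaf u -> (0 < nleaves (hub u))%N.
Proof.
by case: u => // x _; apply/card_gt0P; exists x; rewrite inE /=.
Qed.

Lemma neq_same_hub u v : u != v -> hub u = hub v -> leaf u || leaf v.
Proof. by case: u v => [?|y] [?|z] //= yz eq_yz; rewrite eq_yz eqxx in yz. Qed.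

(** The matrices of a star forest are block diagonal, and on the star of y they
    only see whether a vertex is a leaf.  So the star of y carries two vectors
    [alpha y s], s a boolean, given by their common value on the leaves and
    their value at the hub, with dual vectors [beta y s].  The pairing of
    [beta y s] with [alpha y t] counts the value on leaves [nleaves y] times;
    when it is diagonal, its entries are the eigenvalues of M - b on that star
    up to zeros. *)
Lemma sum_eigenvalues_star (M : X + Y -> X + Y -> algC)
    (alpha beta : Y -> bool -> bool -> algC) (delta : Y -> bool -> algC)
    (b : algC) (g : algC -> algC) :
  (forall u v, M u v = b *+ (u == v) +
     (\sum_s alpha (hub u) s (leaf u) * beta (hub u) s (leaf v))
        *+ (hub u == hub v)) ->
  (forall y s t, beta y s true * alpha y t true *+ nleaves y +
     beta y s false * alpha y t false = delta y s *+ (s == t)) ->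
  \sum_(x <- eigenvalues (vertex_mx M)) g x + g b *+ (2 * #|Y|) =
    \sum_y (g (b + delta y true) + g (b + delta y false))
      + g b *+ (#|X| + #|Y|).
Proof.
move=> ME biorth; rewrite -card_sum.
have ->: (2 * #|Y|)%N = #|{: Y * bool}| by rewrite card_prod card_bool mulnC.
rewrite (sum_eigenvalues_vertex_mx g (d := fun k => delta k.1 k.2)
  (U := fun u k => alpha k.1 k.2 (leaf u) *+ (hub u == k.1))
  (W := fun k u => beta k.1 k.2 (leaf u) *+ (hub u == k.1)) (b := b)).
- rewrite -(pair_bigA _ (fun y s => g (b + delta y s))) /=; congr (_ + _).
  by apply: eq_bigr => y _; rewrite big_bool.
- move=> u v; rewrite ME; congr (_ + _).
  rewrite -(pair_bigA _ (fun y s => alpha y s (leaf u) *+ (hub u == y) *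
    (beta y s (leaf v) *+ (hub v == y)))) /=.
  rewrite (bigD1 (hub u)) //= [X in _ + X]big1 ?addr0; last first.
    move=> y /negPf ny; apply: big1 => s _.
    by rewrite [hub u == y]eq_sym ny mul0r.
  rewrite -sumrMnl; apply: eq_bigr => s _.
  by rewrite eqxx eq_sym mulr1n mulrnAr.
case=> y s [z t] /=; rewrite big_sumType /=.
have [<-|yz] := eqVneq y z; last first.
  rewrite xpair_eqE (negPf yz) big1 ?big1 ?addr0 // => x _.
    by have [->|] := eqVneq x y; rewrite ?(negPf yz) ?mulr0 ?mul0r.
  by have [->|] := eqVneq (h x) y; rewrite ?(negPf yz) ?mulr0 ?mul0r.
rewrite xpair_eqE eqxx /= -biorth (bigD1 y) //= [X in _ + (_ + X)]big1.
  rewrite eqxx addr0 !mulr1n; congr (_ + _).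
  rewrite (bigID (fun x => h x == y)) /= [X in _ + X]big1; last first.
    by move=> x /negPf->; rewrite mul0r.
  rewrite addr0 (eq_bigr (fun=> beta y s true * alpha y t true)).
    by rewrite sumr_const /nleaves cardsE.
  by move=> x ->.
by move=> x /negPf->; rewrite mul0r.
Qed.

Variable E : sgraph (X + Y)%type.
Hypothesis starE : star_forest E.

Lemma degree_star u : degree E u = if leaf u then 1%N else nleaves (hub u).
Proof.
rewrite /degree; case: u => [x|y] /=.
  rewrite -(cards1 (inr (h x) : X + Y)); apply: eq_card => v.
  rewrite !inE starE /=; case: v => z /=; first by rewrite andbF.
  by rewrite andbT eq_sym.
rewrite /nleaves -(card_imset _ (@inl_inj X Y)); apply: eq_card => -[z|z].
  rewrite mem_imset ?inE ?starE /= ?andbT; last exact: inl_inj.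
  by rewrite eq_sym.
rewrite !inE starE /= andbF; apply/esym/negbTE.
by apply/imsetP => -[].
Qed.

Lemma card_edges_star : #|edges E| = #|X|.
Proof.
apply/eqP; rewrite -(eqn_pmul2l (isT : 0 < 2)%N) handshake big_sumType /=.
under eq_bigr do rewrite degree_star.
under [X in (_ + X)%N]eq_bigr do rewrite degree_star.
by rewrite /= sum_nleaves sum1_card mul2n addnn.
Qed.

(** The vectors on a star with d leaves are the eigenvectors (1, sqrt d) and
    (1, - sqrt d).  When d = 0 the division by sqrt d occurs only in values on
    leaves, of which there are none. *)
Lemma energy_star :
  energy E = \sum_y 2 * sqrtC (nleaves y)%:R.
Proof.
have spec := @sum_eigenvalues_star (fun u v => (E u v)%:R)
  (fun y s l => if l then 1 else (-1) ^+ s * sqrtC (nleaves y)%:R)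
  (fun y s l => if l then (-1) ^+ s / (2 * sqrtC (nleaves y)%:R) else 2^-1)
  (fun y s => (-1) ^+ s * sqrtC (nleaves y)%:R) 0 (fun x => `|x|).
have := spec _ _; rewrite normr0 !mul0rn !addr0 /energy => -> //.
- apply: eq_bigr => y _; rewrite !add0r mulN1r mul1r normrN mulr_natl.
  by rewrite ger0_norm ?sqrtC_ge0 ?ler0n.
- move=> u v; rewrite mul0rn add0r starE big_bool /=.
  have [huv|//] /= := eqVneq (hub u) (hub v); rewrite mulr1n.
  have : leaf u || leaf v -> sqrtC (nleaves (hub u))%:R != 0 :> algC.
    rewrite sqrtC_eq0 pnatr_eq0 -lt0n => /orP[|lv].
      exact: nleaves_hub_gt0.
    by rewrite huv nleaves_hub_gt0.
  move: (sqrtC _) => r.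
  by case: (leaf u) (leaf v) => [] [] /= r0; try have {}r0 := r0 isT; field.
- (* Only d * (1 / sqrt d) = sqrt d is used, which holds for d = 0 too, by
     the convention on the inverse of 0. *)
  move=> y s t; rewrite -mulr_natr -[X in _ * X]sqrtCK.
  have [->|r_neq0] := eqVneq (sqrtC (nleaves y)%:R : algC) 0; last first.
    by case: s t => [] [] /=; field.
  by case: s t => [] [] /=; ring.
Qed.

(** The Laplacian is the case of the sign -1, the signless Laplacian that of the
    sign 1.  With e the sign, the vectors on a star with d leaves are (1, e d)
    and (1, - e), with eigenvalues d + 1 and 0; they are orthogonal with squared
    norms d (d + 1) and d + 1.  The dual vectors are scaled by eigenvalue of
    M - 1 over squared norm, 1 / (d + 1) and - 1 / (d + 1), which is defined for
    d = 0 as well. *)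
Lemma sum_eigenvalues_star_laplacian (c : bool) (g : algC -> algC) :
  \sum_(x <- eigenvalues (degree_mx E + (-1) ^+ c *: adjacency_mx E)) g x
      + g 1 *+ (2 * #|Y|) =
    \sum_y (g (nleaves y).+1%:R + g 0) + g 1 *+ (#|X| + #|Y|).
Proof.
pose M u v : algC :=
  (if u == v then (degree E u)%:R else 0) + (-1) ^+ c * (E u v)%:R.
have ->: degree_mx E + (-1) ^+ c *: adjacency_mx E = vertex_mx M.
  by apply/matrixP=> i j; rewrite !mxE.
pose vec y (s l : bool) : algC :=
  if l then 1 else if s then (-1) ^+ c * (nleaves y)%:R else - (-1) ^+ c.
rewrite (@sum_eigenvalues_star M vec
  (fun y s l => vec y s l /
                (if s then (nleaves y).+1%:R else - (nleaves y).+1%:R))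
  (fun y s => if s then (nleaves y)%:R else -1) 1).
- by under eq_bigr do rewrite addrN -mulrS.
- move=> u v; rewrite {}/M {}/vec degree_star starE big_bool /=.
  have [<-|neq_uv] := eqVneq u v.
    rewrite !eqxx andbF mulr0 addr0 !mulr1n -natr1.
    have d0 : (nleaves (hub u))%:R + 1 != 0 :> algC by rewrite natr1 pnatr_eq0.
    move: (nleaves _) d0 => d d0.
    by case: (leaf u) c => [] [] /=; field.
  rewrite mulr0n !add0r.
  have [huv|_] /= := eqVneq (hub u) (hub v); last by rewrite mulr0.
  have := neq_same_hub neq_uv huv.
  have d0 : (nleaves (hub u)).+1%:R != 0 :> algC by rewrite pnatr_eq0.
  rewrite -natr1 in d0 *; move: (nleaves _) d0 => d d0.
  by case: (leaf u) (leaf v) => [] [] //= _; field.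
move=> {M} y s t; rewrite {}/vec -mulr_natr -natr1.
have d0 : (nleaves y)%:R + 1 != 0 :> algC by rewrite natr1 pnatr_eq0.
move: (nleaves y) d0 => d d0.
by case: s t c => [] [] [] /=; field.
Qed.

(** Distinct vertices with a common neighbor are leaves of the same star, and
    the hub is then the only one: two hubs share no leaf. *)
Lemma card_common_nbrs_star u v : u != v ->
  #|common_nbrs E u v| = [&& hub u == hub v, leaf u & leaf v] :> nat.
Proof.
move=> neq_uv; have [/and3P[/eqP huv lu lv]|not_leaves] := boolP [&& _, _ & _].
  rewrite -[RHS](cards1 (inr (hub u) : X + Y)); apply: eq_card => w.
  rewrite !inE !starE lu lv -huv; case: w u v lu lv {neq_uv huv} => [x|y].
    by move=> *; rewrite !andbF.
  by case=> // x [x'|//] _ _ /=; rewrite !andbT andbb [RHS]eq_sym.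
apply: eq_card0 => w; rewrite !inE !starE.
apply/and4P=> -[_ _ /andP[/eqP huw luw] /andP[/eqP hvw lvw]].
move: not_leaves neq_uv; rewrite huw hvw eqxx /=.
case: u v w huw hvw luw lvw => [x|y] [x'|y'] [x''|y''] //= -> ->.
by rewrite eqxx.
Qed.

(** On a star with d leaves, CN + 1 is the all-ones matrix on the leaves and 1
    at the hub, so the indicators of the leaves and of the hub are eigenvectors
    for d and 1. *)
Lemma cn_energy_star :
  cn_energy E + (2 * #|Y|)%:R =
    \sum_y `|(nleaves y)%:R - 1| + (#|X| + #|Y|)%:R.
Proof.
have := @sum_eigenvalues_star
  (fun u v => if u == v then 0 else #|common_nbrs E u v|%:R)
  (fun y s l => (s == l)%:R) (fun y s l => (s == l)%:R)
  (fun y s => if s then (nleaves y)%:R else 1) (-1) (fun x => `|x|).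
rewrite normrN1 addNr normr0 => -> //.
- by congr (_ + _); apply: eq_bigr => y _; rewrite addr0 [-1 + _]addrC.
- move=> u v; rewrite big_bool; have [<-|neq_uv] := eqVneq u v.
    by rewrite eqxx; case: (leaf u); rewrite /= ?mul1r ?mul0r; ring.
  rewrite mulr0n add0r card_common_nbrs_star //.
  have [huv|//] := eqVneq (hub u) (hub v).
  have := neq_same_hub neq_uv huv.
  by case: (leaf u) (leaf v) => [] [] //= _; ring.
by move=> y [] [] /=; rewrite -mulr_natr; ring.
Qed.

(** * Bounds on the energies of star forests *)

(** The gap between d + 1 and 2 sqrt d is the square of sqrt d - 1. *)
Lemma energy_star_leif :
  energy E <= (#|X| + #|Y|)%:R ?= iff [forall y, nleaves y == 1%N].
Proof.
rewrite -sum_nleavesS energy_star; apply: leif_sum => y _.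
set r : algC := sqrtC _.
have ->: (nleaves y)%:R = r ^+ 2 by rewrite sqrtCK.
have r_ge0 : 0 <= r by rewrite sqrtC_ge0 ler0n.
have gap : r ^+ 2 + 1 - 2 * r = (r - 1) ^+ 2 by ring.
split; first by rewrite -subr_ge0 gap real_exprn_even_ge0 // realB ?ger0_real.
rewrite eq_sym -subr_eq0 gap expf_eq0 /= subr_eq0.
by rewrite -(pexpr_eq1 (n := 2)) // sqrtCK pnatr_eq1.
Qed.

(** The triangle inequality |d + 1 - c| <= d + |1 - c| is uniform in d, so that
    only the number of stars enters the bound. *)
Lemma star_laplacian_energy_le (c : bool) :
  (0 < #|X|)%N -> (0 < #|Y|)%N ->
  \sum_(x <- eigenvalues (degree_mx E + (-1) ^+ c *: adjacency_mx E))
     `|x - avg_degree E| <= 2 * (#|{: X + Y}|%:R - 1).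
Proof.
move=> X_gt0 Y_gt0.
have := sum_eigenvalues_star_laplacian c (fun x => `|x - avg_degree E|).
move: (\sum_(x <- _) _) => S.
have: \sum_y (`|(nleaves y).+1%:R - avg_degree E| + `|0 - avg_degree E|) <=
    \sum_y ((nleaves y)%:R + (`|1 - avg_degree E| + avg_degree E)).
  apply: ler_sum => y _; rewrite [leRHS]addrA sub0r normrN.
  rewrite [X in _ + X <= _]ger0_norm ?divr_ge0 ?ler0n //.
  by rewrite lerD2r mulrSr -addrA (le_trans (ler_normD _ _)) // normr_nat.
rewrite [leRHS]big_split /= -natr_sum sum_nleaves sumr_const.
rewrite /avg_degree card_edges_star card_sum.
set t := `|1 - _|; rewrite -[_ *+ #|Y|]mulr_natr => le_sum.
rewrite -[t *+ (2 * _)]mulr_natr -[t *+ (_ + _)]mulr_natr => SE.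
have natS (n : nat) : (0 < n)%N -> n%:R = n.-1%:R + 1 :> algC.
  by move=> n_gt0; rewrite natr1 prednK.
have XY2 : #|X|.-1%:R + 1 + (#|Y|.-1%:R + 1) =
           #|X|.-1%:R + #|Y|.-1%:R + 2 :> algC by ring.
move: le_sum; rewrite -(lerD2r (t * (#|X| + #|Y|)%:R)) -{}SE.
rewrite /t {t} !(natrM, natrD) (natS _ X_gt0) (natS _ Y_gt0) XY2.
move/star_laplacian_bound=> le_S; rewrite -[_ - 1]addrA addrK.
by apply: le_S; apply: ler0n.
Qed.

Lemma cn_energy_star_le : cn_energy E <= 2 * #|X|%:R.
Proof.
rewrite -(lerD2r (2 * #|Y|)%:R) cn_energy_star.
have: \sum_y `|(nleaves y)%:R - 1| <= \sum_y ((nleaves y)%:R + 1) :> algC.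
  apply: ler_sum => y _; rewrite (le_trans (ler_normB _ _)) //.
  by rewrite normr1 normr_nat.
rewrite sum_nleavesS => le_sum.
rewrite (le_trans (lerD le_sum (lexx _))) // -natrM -!natrD ler_nat.
by rewrite addnn -mul2n mulnDr.
Qed.

End StarForest.

(** * Energies of the complete graph *)

(** The matrix is b 1 + a J, and J is the product of the all-ones column by the
    all-ones row, whose product in the other order is the number of vertices. *)
Lemma sum_eigenvalues_complete (V : finType) (M : V -> V -> algC)
    (a b : algC) (g : algC -> algC) :
  (forall u v, M u v = b *+ (u == v) + a) ->
  \sum_(x <- eigenvalues (vertex_mx M)) g x + g b =
    g (b + a *+ #|V|) + g b *+ #|V|.
Proof.
move=> ME; have ME1 u v : M u v = b *+ (u == v) + \sum_(k : unit) a * 1.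
  by rewrite sumr_const card_unit mulr1.
have := @sum_eigenvalues_vertex_mx V unit M (fun _ _ => a)
  (fun _ _ => 1) (fun=> a *+ #|V|) b g.
rewrite card_unit => -> //; first by rewrite sumr_const card_unit.
move=> [] []; rewrite eqxx mulr1n.
by under eq_bigr do rewrite mul1r; rewrite sumr_const.
Qed.

Section CompleteGraph.

Variable V : finType.
Hypothesis V_gt0 : (0 < #|V|)%N.
Let K := complete_graph V.

Lemma degree_complete (u : V) : degree K u = #|V|.-1.
Proof.
by rewrite -(cardC1 u); apply: eq_card => v; rewrite !inE eq_sym.
Qed.

Lemma avg_degree_complete : avg_degree K = #|V|%:R - 1.
Proof.
rewrite /avg_degree handshake; under eq_bigr do rewrite degree_complete.
rewrite sum_nat_const natrM mulrAC divff ?pnatr_eq0 -?lt0n // mul1r.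
by rewrite -subn1 natrB.
Qed.

Lemma common_nbrs_complete (u v : V) :
  u != v -> #|common_nbrs K u v| = (#|V| - 2)%N.
Proof.
move=> neq_uv; rewrite -(cardsC [set u; v]) cards2 neq_uv addKn.
apply: eq_card => w.
by rewrite !inE /= negb_or (eq_sym u) (eq_sym v) andbA andbb.
Qed.

Let predV : #|V|%:R = #|V|.-1%:R + 1 :> algC.
Proof. by rewrite natr1 prednK. Qed.

Lemma energy_complete : energy K = 2 * (#|V|%:R - 1).
Proof.
have := @sum_eigenvalues_complete V
  (fun u v => (u != v)%:R) 1 (-1) (fun x => `|x|).
rewrite -/(adjacency_mx K) -/(energy K) normrN1 -mulr_natr predV.
rewrite [-1 + _]addrC addrK normr_nat => specE; apply: (addIr 1).
rewrite specE; first by ring.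
by move=> u v; case: eqVneq => _ /=; ring.
Qed.

Lemma laplacian_energy_complete (c : bool) :
  \sum_(x <- eigenvalues (degree_mx K + (-1) ^+ c *: adjacency_mx K))
     `|x - avg_degree K| = 2 * (#|V|%:R - 1).
Proof.
pose M u v : algC :=
  (if u == v then (degree K u)%:R else 0) + (-1) ^+ c * (u != v)%:R.
have ->: degree_mx K + (-1) ^+ c *: adjacency_mx K = vertex_mx M.
  by apply/matrixP=> i j; rewrite !mxE.
have := @sum_eigenvalues_complete V M ((-1) ^+ c) (#|V|.-1%:R - (-1) ^+ c)
  (fun x => `|x - avg_degree K|).
rewrite avg_degree_complete -[(-1) ^+ c *+ _]mulr_natr.
rewrite -[`|_| *+ #|V|]mulr_natr predV.
set m : algC := #|V|.-1%:R.
have -> : m - (-1) ^+ c - (m + 1 - 1) = - (-1) ^+ c by ring.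
have -> : m - (-1) ^+ c + (-1) ^+ c * (m + 1) - (m + 1 - 1) = (-1) ^+ c * m.
  by ring.
rewrite normrN normrM normr_sign mul1r normr_nat => specM; apply: (addIr 1).
rewrite specM; first by ring.
by move=> u v; rewrite /M degree_complete; case: eqVneq => _ /=; ring.
Qed.

Lemma cn_energy_complete :
  cn_energy K = (2 * (#|V| - 1) * (#|V| - 2))%:R.
Proof.
have := @sum_eigenvalues_complete V
  (fun u v => if u == v then 0 else #|common_nbrs K u v|%:R)
  (#|V| - 2)%:R (- (#|V| - 2)%:R) (fun x => `|x|).
rewrite -/(common_nbr_mx K) -/(cn_energy K) normrN normr_nat subn1.
set k := (#|V| - 2)%N; rewrite -[k%:R *+ _]mulr_natr predV.
have -> : - k%:R + k%:R * (#|V|.-1%:R + 1) = (k * #|V|.-1)%:R :> algC.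
  by rewrite natrM; ring.
rewrite normr_nat => specM; apply: (addIr k%:R); rewrite specM.
  by rewrite !natrM; ring.
move=> u v; have [_|neq_uv] := eqVneq u v; first by rewrite addNr.
by rewrite common_nbrs_complete // add0r.
Qed.

End CompleteGraph.

(** * Star forests against complete graphs *)

Section StarForestNotHyperenergetic.

Variables (X Y : finType) (h : X -> Y) (E : sgraph (X + Y)%type).
Hypotheses (starE : star_forest h E).
Hypotheses (X_gt1 : (1 < #|X|)%N) (Y_gt0 : (0 < #|Y|)%N).

Let X_gt0 : (0 < #|X|)%N := ltnW X_gt1.
Let V_gt2 : (2 < #|{: X + Y}|)%N.
Proof. by rewrite card_sum -(addn1 2) leq_add. Qed.
Let V_gt0 : (0 < #|{: X + Y}|)%N := ltnW (ltnW V_gt2).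

Lemma hypoenergetic_star y : nleaves h y != 1%N -> hypoenergetic E.
Proof.
move=> y_neq1; rewrite /hypoenergetic card_sum.
rewrite (lt_leif (energy_star_leif starE)).
by apply/forallPn; exists y.
Qed.

Lemma not_hyperenergetic_star : ~~ hyperenergetic E.
Proof.
rewrite /hyperenergetic energy_complete // le_gtF //.
rewrite (le_trans (energy_star_leif starE)) // -card_sum.
rewrite -subr_ge0 (_ : _ - _ = #|{: X + Y}|%:R - 2%:R); last by ring.
by rewrite subr_ge0 ler_nat ltnW.
Qed.

Lemma not_L_hyperenergetic_star : ~~ L_hyperenergetic E.
Proof.
have := star_laplacian_energy_le starE true X_gt0 Y_gt0.
rewrite -(laplacian_energy_complete V_gt0 true) expr1 !scaleN1r.
by move/le_gtF; rewrite /L_hyperenergetic => ->.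
Qed.

Lemma not_Q_hyperenergetic_star : ~~ Q_hyperenergetic E.
Proof.
have := star_laplacian_energy_le starE false X_gt0 Y_gt0.
rewrite -(laplacian_energy_complete V_gt0 false) expr0 !scale1r.
by move/le_gtF; rewrite /Q_hyperenergetic => ->.
Qed.

Lemma not_CN_hyperenergetic_star : ~~ CN_hyperenergetic E.
Proof.
rewrite /CN_hyperenergetic cn_energy_complete // le_gtF //.
rewrite (le_trans (cn_energy_star_le starE)) // -natrM ler_nat.
rewrite -mulnA leq_mul2l /=.
by rewrite -[#|X|]muln1 leq_mul // ?subn_gt0 // card_sum leq_subRL; lia.
Qed.

End StarForestNotHyperenergetic.

(** * The subgroup generating bipartite graph *)

Section SubgroupGeneratingGraph.

Variable gT : finGroupType.

Definition generated_pair (x : gT * gT) : {group gT} := <<[set x.1; x.2]>>%G.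

Lemma sgb_star_forest : star_forest generated_pair (sgb_graph gT).
Proof.
by case=> [x|H] [y|K]; rewrite /= ?andbF // andbT -?val_eqE // eq_sym.
Qed.

(** If (x, y) were the only generating pair, the generating pairs (y, x) and
    then (1, x) would coincide with it, forcing x = y = 1. *)
Lemma nleaves_generated_setT :
  (1 < #|[set: gT]|)%N -> nleaves generated_pair [set: gT]%G != 1%N.
Proof.
move=> gT_gt1; apply/negP => /cards1P[[x y] /setP gen].
have genP u v : (<<[set u; v]>> == [set: gT])%g = ((u, v) == (x, y)).
  by have := gen (u, v); rewrite !inE.
have genxy : (<<[set x; y]>> == [set: gT])%g by rewrite genP.
have /eqP[eq_yx _] : (y, x) == (x, y) by rewrite -genP setUC.
rewrite eq_yx setUid in genP genxy.
have /eqP[eq_1x] : (1%g, x) == (x, x).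
  by rewrite -genP eqEsubset subsetT -(eqP genxy) genS // subsetUr.
by move: gT_gt1; rewrite -(eqP genxy) -eq_1x -/(cycle 1) cycle1 cards1.
Qed.

End SubgroupGeneratingGraph.

(** Sending a to 1 and b to the generator of the group of order 2 respects the
    relations, so that group is a quotient. *)
Lemma dicyclic_nontrivial m (gT : finGroupType) :
  dicyclic m [set: gT] -> (1 < #|[set: gT]|)%N.
Proof.
move=> dicG.
pose Z2 := [set: 'I_2]%G.
have homG : (Z2 \homg [set: gT])%g.
  rewrite dicG; apply/existsP; exists (1%g, Zp1 : 'I_2); rewrite /= !xpair_eqE.
  rewrite cycle1 joing1G mulg1 mulgV invg1 !expg1n !eqxx andbT /=.
  apply/andP; split; first by apply/eqP; symmetry; exact: (Zp_cycle 1).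
  by apply/eqP/val_inj.
rewrite (leq_trans _ (dvdn_leq _ (card_homg homG))) ?cardG_gt0 //.
by rewrite cardsT card_ord.
Qed.

Theorem theorem4p5 (p : nat) (hp : prime p) (gT : finGroupType)
    (hG : dicyclic p [set: gT]) :
  [/\ hypoenergetic (sgb_graph gT),
      ~~ hyperenergetic (sgb_graph gT),
      ~~ L_hyperenergetic (sgb_graph gT),
      ~~ Q_hyperenergetic (sgb_graph gT)
    & ~~ CN_hyperenergetic (sgb_graph gT)].
Proof.
have gT_gt1 := dicyclic_nontrivial hG.
have star := @sgb_star_forest gT.
have X_gt1 : (1 < #|{: gT * gT}|)%N.
  by rewrite card_prod -cardsT (ltn_mul gT_gt1 gT_gt1).
have Y_gt0 : (0 < #|{: {group gT}}|)%N by apply/card_gt0P; exists 1%G.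
split.
- exact: (hypoenergetic_star star (nleaves_generated_setT gT_gt1)).
- exact: (not_hyperenergetic_star star X_gt1 Y_gt0).
- exact: (not_L_hyperenergetic_star star X_gt1 Y_gt0).
- exact: (not_Q_hyperenergetic_star star X_gt1 Y_gt0).
exact: (not_CN_hyperenergetic_star star X_gt1 Y_gt0).
Qed.
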